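(* Let $\mathcal{D}$ be a weakly self-orthogonal $1$-$(v,k,r)$ design such that $k$ is even and the block intersection numbers are odd. Let $G$ be an automorphism group of $\mathcal{D}$ acting with $f_1$ fixed points and $n$ point orbits of length $2$, and with $f_2$ fixed blocks and $m$ block orbits of length $2$ (and no other orbits). Let $OM1$ and $OM2$ be, respectively, the submatrix of the orbit matrix indexed by fixed blocks and fixed points, and the submatrix indexed by block orbits and point orbits of length $2$. Then: 1. the binary linear code spanned by the rows of the matrix $[I_{f_2},\ OM1,\ \mathbf{1}]$ is a self-orthogonal code of length $f_2+f_1+1$ and dimension $f_2$; 2. the binary linear code spanned by the rows of the matrix $[I_m,\ OM2]$ is a self-orthogonal code of length $m+n$ and dimension $m$. If $m=n$, the obtained code is self-dual.
   Context: A $1$-$(v,k,r)$ design is a finite incidence structure with $v$ points such that every block is incident with exactly $k$ points and every point is incident with exactly $r$ blocks. The block intersection numbers are the numbers $|B\cap B'|$ of points incident with both of two different blocks $B\neq B'$; the design is weakly self-orthogonal if all of them have the same parity. An automorphism group of $\mathcal{D}$ is a group of incidence-preserving bijections (points to points, blocks to blocks) of $\mathcal{D}$. The orbit matrix under $G$ has rows indexed by block orbits $\mathcal{B}_i$ and columns by point orbits $\mathcal{V}_j$, with entry $a_{i,j}$ equal to the number of points of $\mathcal{V}_j$ incident with a block of $\mathcal{B}_i$ (independent of the chosen block). Order the orbits so that fixed points (columns $1,\ldots,f_1$) and fixed blocks (rows $1,\ldots,f_2$) come first. Then $OM1=[a_{i,j}]_{1\le i\le f_2,\,1\le j\le f_1}$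 and $OM2=[a_{f_2+i,f_1+j}]_{1\le i\le m,\,1\le j\le n}$, with entries reduced into $\mathbb{F}_2$. $I_N$ is the identity matrix, $\mathbf{1}$ the all-one column, and $[X,Y,\ldots]$ denotes horizontal concatenation. A code $C\subseteq\mathbb{F}_2^N$ is self-orthogonal if $C\subseteq C^\perp$ and self-dual if $C=C^\perp$, where $C^\perp$ is the dual under the standard inner product. *)

(* Defs.v *)
From HB Require Import structures.
From mathcomp Require Import all_boot all_order all_algebra all_fingroup.
Set Implicit Arguments.
Unset Strict Implicit.
Unset Printing Implicit Defensive.

Import GroupScope GRing.Theory.

(* Points and blocks are separate finite types, so distinct blocks may be
   incident with the same points. *)
Section IncidenceStructures.

Variables (P B : finType) (inc : P -> B -> bool).

Definition one_design (v k r : nat) : Prop :=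
  [/\ #|P| = v,
      forall b : B, #|[set x | inc x b]| = k
    & forall x : P, #|[set b | inc x b]| = r].

Definition block_intersection (b c : B) : nat :=
  #|[set x | inc x b & inc x c]|.

Definition weakly_self_orthogonal : Prop :=
  forall b c b' c' : B, b != c -> b' != c' ->
    odd (block_intersection b c) = odd (block_intersection b' c').

Definition odd_block_intersections : Prop :=
  forall b c : B, b != c -> odd (block_intersection b c).

(* A pair acts by its first component on points and by its second on blocks. *)
Definition automorphism_group (G : {group {perm P} * {perm B}}) : Prop :=
  forall g, g \in G -> forall x b, inc (g.1 x) (g.2 b) = inc x b.

Definition point_act (x : P) (g : {perm P} * {perm B}) : P := g.1 x.
Definition block_act (b : B) (g : {perm P} * {perm B}) : B := g.2 b.

Fact point_act1 : point_act^~ 1 =1 id.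
Proof. by move=> x; rewrite /point_act perm1. Qed.

Fact point_actM x : act_morph point_act x.
Proof. by move=> g h; rewrite /point_act permM. Qed.

Fact block_act1 : block_act^~ 1 =1 id.
Proof. by move=> b; rewrite /block_act perm1. Qed.

Fact block_actM b : act_morph block_act b.
Proof. by move=> g h; rewrite /block_act permM. Qed.

Canonical point_action := TotalAction point_act1 point_actM.
Canonical block_action := TotalAction block_act1 block_actM.

Definition orbit_entry (W : {set B}) (V : {set P}) : nat :=
  if [pick b in W] is Some b then #|[set x in V | inc x b]| else 0.

Lemma orbit_entryE (G : {group {perm P} * {perm B}}) (b c : B) (x : P) :
  automorphism_group G -> c \in orbit block_action G b ->
  orbit_entry (orbit block_action G b) (orbit point_action G x)
    = #|[set y in orbit point_action G x | inc y c]|.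
Proof.
move=> autG cb; rewrite /orbit_entry; case: pickP => [d db|/(_ c)]; last first.
  by rewrite cb.
have /orbitP[g gG <-] : c \in orbit block_action G d.
  by rewrite (orbit_eqP db).
rewrite -(card_imset _ (@perm_inj _ g.1)); apply: eq_card => y.
apply/imsetP/idP => [[z]|].
  rewrite !inE => /andP[zx zd] ->; rewrite autG // zd andbT.
  by rewrite -[g.1 z]/(point_action z g) orbit_actr.
rewrite inE => /andP[yx yd]; exists (point_action y g^-1); last first.
  by rewrite -[RHS]/(point_action (point_action y g^-1) g) actKVin.
rewrite inE orbit_actr ?groupV // yx /=.
by rewrite -(autG g gG) -[g.1 _]/(point_action (point_action y g^-1) g) actKVin.
Qed.

Definition orbit_matrix (p q : nat) (W : 'I_p -> {set B}) (V : 'I_q -> {set P})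
    : 'M[nat]_(p, q) :=
  \matrix_(i, j) orbit_entry (W i) (V j).

End IncidenceStructures.

(* [V] lists every orbit exactly once: the [f] fixed points, then the [n]
   orbits of length 2; in particular no orbit has another length. *)
Definition orbit_ordering (aT : finGroupType) (T : finType)
    (to : {action aT &-> T}) (G : {group aT}) (f n : nat)
    (V : 'I_(f + n) -> {set T}) : Prop :=
  [/\ injective V,
      [set V i | i : 'I_(f + n)] = [set orbit to G x | x : T],
      forall i : 'I_f, #|V (lshift n i)| = 1%N
    & forall j : 'I_n, #|V (rshift f j)| = 2].

Local Open Scope ring_scope.

Definition mod2 (p q : nat) (A : 'M[nat]_(p, q)) : 'M['F_2]_(p, q) :=
  map_mx (fun a : nat => a%:R) A.

Definition OM1 (f2 m f1 n : nat) (A : 'M[nat]_(f2 + m, f1 + n)) :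
    'M['F_2]_(f2, f1) :=
  mod2 (ulsubmx A).

Definition OM2 (f2 m f1 n : nat) (A : 'M[nat]_(f2 + m, f1 + n)) :
    'M['F_2]_(m, n) :=
  mod2 (drsubmx A).

Definition row_code (p N : nat) (M : 'M['F_2]_(p, N)) :
    {vspace 'rV['F_2]_N} :=
  <<[seq row i M | i <- enum 'I_p]>>%VS.

Definition dual_code (N : nat) (C : {vspace 'rV['F_2]_N}) :
    {set 'rV['F_2]_N} :=
  [set x : 'rV['F_2]_N | [forall y : 'rV['F_2]_N in C,
      \sum_(i < N) x 0 i * y 0 i == 0]].

Definition self_orthogonal (N : nat) (C : {vspace 'rV['F_2]_N}) : Prop :=
  {subset C <= dual_code C}.

Definition self_dual (N : nat) (C : {vspace 'rV['F_2]_N}) : Prop :=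
  C =i dual_code C.

(* Main.v *)
Require Import Defs.
From HB Require Import structures.
From mathcomp Require Import all_boot all_order all_algebra all_fingroup.
Set Implicit Arguments.
Unset Strict Implicit.
Unset Printing Implicit Defensive.

Import GroupScope GRing.Theory.
Local Open Scope ring_scope.

(** A binary code spanned by the rows of M is self-orthogonal exactly because
    the Gram matrix M *m M^T vanishes, and an identity block makes the rows
    independent, so everything reduces to the Gram matrices of OM1 and OM2.

    For OM1, a block fixed by G is a union of orbits, so it meets each point
    orbit of length 2 in an even number of points.  Modulo 2 the number of
    common points of two fixed blocks is therefore the number of common fixed
    points, the inner product of their rows (OM1_dot).  It is 0 on the diagonal
    (k is even) and 1 off it, so OM1 has Gram matrix J + I with J the all-one
    matrix; the identity block adds I and the all-one column adds J.

    For OM2, let b lie in a block orbit of length 2 and let g in G move b.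
    Then for every block c the inner product of the rows of b and c is
      |b meet c| + |b meet cg|  modulo 2                            (OM2_dot).
    If g swaps the points of a 2-orbit, its contributions to the two
    intersections together count the pairs in V x V with first point in b and
    second point in c, a number which is the product of the two matrix entries.
    If g fixes a 2-orbit pointwise, the contributions are equal and cancel, and
    the matrix entry of b is even: some element fixes b and swaps the points
    (card2_entry_even).  This last case occurs since G, an arbitrary group with
    orbits of length at most 2, need not have order 2.  When c lies in another
    orbit both intersection numbers are odd, and when c = b they are k, even,
    and an odd number; so OM2 has Gram matrix I, cancelled by the identity block.

    If moreover OM2 is square, OM2^T is a two-sided inverse, and a word (u, w)
    orthogonal to every row satisfies u = w OM2^T, hence w = u OM2: it is the
    codeword u [I, OM2]. *)

(** * Binary codes given by generator matrices *)

Section BinaryCodes.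

Lemma natr_F2 (a : nat) : a%:R = (odd a)%:R :> 'F_2.
Proof. by rewrite -modn2 Fp_nat_mod. Qed.

Lemma natr_F2_eq (a b : nat) : odd a = odd b -> a%:R = b%:R :> 'F_2.
Proof. by move=> eq_odd; rewrite (natr_F2 a) eq_odd -natr_F2. Qed.

Lemma addrr_F2 (p q : nat) (M : 'M['F_2]_(p, q)) : M + M = 0.
Proof.
by apply/matrixP => i j; rewrite !mxE -mulr2n -mulr_natr natr_F2 mulr0.
Qed.

Lemma opp_F2 (p q : nat) (M : 'M['F_2]_(p, q)) : - M = M.
Proof. by apply/eqP; rewrite eq_sym -addr_eq0 addrr_F2. Qed.

Variables (p N : nat).
Implicit Types (M : 'M['F_2]_(p, N)) (x : 'rV['F_2]_N).

Let rows M := [tuple row i M | i < p].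

Let nth_rows M (i : 'I_p) : (rows M)`_i = row i M.
Proof. by rewrite -tnth_nth tnth_mktuple. Qed.

Let row_code_span M : row_code M = <<rows M>>%VS.
Proof. by rewrite /row_code /= /image_mem enumT. Qed.

(** The code as the image of the encoding map turns orthogonality and
    self-duality into matrix identities. *)
Lemma row_codeP M x :
  reflect (exists u : 'rV_p, x = u *m M) (x \in row_code M).
Proof.
rewrite row_code_span; apply: (iffP idP) => [/coord_span ->|[u ->]].
  exists (\row_i coord (rows M) i x); rewrite mulmx_sum_row.
  by apply: eq_bigr => i _; rewrite mxE nth_rows.
rewrite mulmx_sum_row; apply: memv_suml => i _; apply: memvZ.
by rewrite -nth_rows; apply/memv_span/mem_nth; rewrite size_tuple.
Qed.

Lemma dual_row_code M x :
  (x \in dual_code (row_code M)) = (x *m M^T == 0).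
Proof.
have dotE (y : 'rV_N) : \sum_(i < N) x 0 i * y 0 i = (x *m y^T) 0 0.
  by rewrite mxE; apply: eq_bigr => i _; rewrite mxE.
rewrite inE; apply/forall_inP/eqP => [orth | xM0 y /row_codeP[u ->]].
  apply/rowP => i; rewrite mxE [RHS]mxE.
  have /orth/eqP : row i M \in row_code M.
    by apply/row_codeP; exists (delta_mx 0 i); rewrite rowE.
  by apply: etrans; apply: eq_bigr => j _; rewrite !mxE.
by rewrite dotE trmx_mul mulmxA xM0 mul0mx mxE.
Qed.

Lemma self_orthogonal_row_code M :
  M *m M^T = 0 -> self_orthogonal (row_code M).
Proof.
move=> MM0 _ /row_codeP[u ->].
by rewrite dual_row_code -mulmxA MM0 mulmx0.
Qed.

Lemma dim_row_code M : row_free M -> \dim (row_code M) = p.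
Proof.
move=> freeM; rewrite row_code_span.
have /eqP -> : free (rows M); last by rewrite size_tuple.
apply/freeP => a sum0 i.
suff /rowP/(_ i) : \row_i a i = 0 by rewrite !mxE.
apply: (row_free_inj freeM); rewrite mul0mx mulmx_sum_row -[RHS]sum0.
by apply: eq_bigr => j _; rewrite mxE nth_rows.
Qed.

End BinaryCodes.

(** * Systematic generator matrices *)

Lemma row_free_row_mx (F : fieldType) (p q s : nat)
    (X : 'M[F]_(p, q)) (Y : 'M[F]_(p, s)) :
  row_free X -> row_free (row_mx X Y).
Proof.
case/row_freeP => Z XZ; apply/row_freeP; exists (col_mx Z 0).
by rewrite mul_row_col XZ mulmx0 addr0.
Qed.

Lemma row_free1 (F : fieldType) (p : nat) : row_free (1%:M : 'M[F]_p).
Proof. by rewrite row_free_unit unitmx1. Qed.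

(** The matrix X is orthogonal, so X^T *m X = 1 as well; this solves the parity
    check equations of the dual code for the last n coordinates. *)
Lemma self_dual_systematic (m n : nat) (X : 'M['F_2]_(m, n)) :
  m = n -> X *m X^T = 1%:M -> self_dual (row_code (row_mx 1%:M X)).
Proof.
move=> eq_mn; subst n => XXT.
have XTX : X^T *m X = 1%:M by apply: mulmx1C.
move=> x; apply/idP/idP.
  apply: self_orthogonal_row_code.
  by rewrite tr_row_mx mul_row_col trmx1 mulmx1 XXT addrr_F2.
rewrite dual_row_code -[x]hsubmxK; set u := lsubmx x; set w := rsubmx x.
rewrite tr_row_mx mul_row_col trmx1 mulmx1 addr_eq0 opp_F2 => /eqP u_w.
apply/row_codeP; exists u.
rewrite mul_mx_row mulmx1; congr row_mx.
by rewrite u_w -mulmxA XTX mulmx1.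
Qed.

(** * Orbits of length two *)

Section SmallOrbits.

Variables (aT : finGroupType) (T : finType) (to : {action aT &-> T}).
Variable (G : {group aT}).
Implicit Types (x : T) (g h : aT) (X : {set T}).

Lemma card_set1I x X : #|[set x] :&: X| = (x \in X).
Proof.
rewrite -sum1_card (eq_bigl _ _ (fun y => in_setI y _ X)) big_mkcondr /=.
by rewrite big_set1; case: (x \in X).
Qed.

Lemma card2_orbit_moved x :
  #|orbit to G x| = 2 -> exists2 g, g \in G & to x g != x.
Proof.
move=> card2.
have /subsetPn[_ /orbitP[g gG <-]] : ~~ (orbit to G x \subset [set x]).
  apply: contra_eqN card2 => /subset_leq_card.
  by rewrite cards1; case: #|_| => [|[|]].
by rewrite inE; exists g.
Qed.

Lemma card2_orbitE x g :
  #|orbit to G x| = 2 -> g \in G -> to x g != x ->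
  orbit to G x = [set x; to x g].
Proof.
move=> card2 gG xg; apply/esym/eqP; rewrite eqEcard subUset !sub1set.
by rewrite orbit_refl mem_orbit //= card2 cards2 eq_sym xg.
Qed.

Lemma card2_orbitI x g X :
  #|orbit to G x| = 2 -> g \in G -> to x g != x ->
  #|orbit to G x :&: X| = ((x \in X) + (to x g \in X))%N.
Proof.
move=> card2 gG xg; rewrite (card2_orbitE card2 gG xg).
rewrite -sum1_card (eq_bigl _ _ (fun y => in_setI y _ X)) big_mkcondr /=.
by rewrite big_setU1 ?inE 1?eq_sym //= big_set1; do 2!case: (_ \in X).
Qed.

Lemma card2_orbit_invol x g :
  #|orbit to G x| = 2 -> g \in G -> to (to x g) g = x.
Proof.
move=> card2 gG; have [xg|xg] := eqVneq (to x g) x; first by rewrite !xg.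
have : to (to x g) g \in orbit to G x by rewrite orbit_actr // mem_orbit.
rewrite (card2_orbitE card2 gG xg) !inE => /orP[/eqP //|].
by rewrite (inj_eq (act_inj to g)) (negPf xg).
Qed.

(** Orbits of length 2 are fixed pointwise by g or have their points swapped
    by g. *)
Lemma card2_orbit_fixed x y g :
  #|orbit to G x| = 2 -> g \in G -> to x g = x ->
  y \in orbit to G x -> to y g = y.
Proof.
move=> card2 gG xg /orbit_eqP oyx; apply/eqP/idPn => yg.
have cardy : #|orbit to G y| = 2 by rewrite oyx.
have : x \in orbit to G y by rewrite oyx orbit_refl.
rewrite (card2_orbitE cardy gG yg) !inE => /orP[]/eqP xy.
  by rewrite -xy xg eqxx in yg.
have := card2_orbit_invol cardy gG.
by rewrite -xy xg => e; rewrite -e xg eqxx in yg.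
Qed.

Lemma card2_orbit_act_eq x g h :
  #|orbit to G x| = 2 -> g \in G -> h \in G ->
  to x g != x -> to x h != x -> to x g = to x h.
Proof.
move=> card2 gG hG xg xh.
have := mem_orbit to x hG; rewrite (card2_orbitE card2 gG xg) !inE (negPf xh).
by move/eqP.
Qed.

Lemma orbit_ordering_orbit f n (V : 'I_(f + n) -> {set T}) i :
  orbit_ordering to G V -> exists x, V i = orbit to G x.
Proof.
case=> _ imV _ _.
have /imsetP[x _ Vi] : V i \in [set orbit to G x | x : T].
  by rewrite -imV imset_f.
by exists x.
Qed.

(** The orbits partition the set, so cardinalities can be computed along the
    listed orbits. *)
Lemma card_orbit_ordering f n (V : 'I_(f + n) -> {set T}) X :
  orbit_ordering to G V -> #|X| = (\sum_i #|V i :&: X|)%N.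
Proof.
case=> injV imV _ _; rewrite -sum1_card.
have acts : [acts G, on [set: T] | to].
  by apply/actsP => g _ x; rewrite !inE.
rewrite (eq_bigl (fun x => (x \in [set: T]) && (x \in X))) => [|x]; last first.
  by rewrite inE.
rewrite (set_partition_big_cond _ (orbit_partition acts)) /=.
have -> : [set orbit to G x | x in [set: T]] = [set V i | i : 'I_(f + n)].
  by rewrite imV; apply/setP => A; apply/imsetP/imsetP => -[x _ ->]; exists x.
rewrite big_imset /=; last by move=> i j _ _; apply: injV.
apply: eq_bigr => i _; rewrite -sum1_card; apply: eq_bigl => x.
by rewrite inE.
Qed.

Lemma card2_orbitI_even x h X :
  #|orbit to G x| = 2 -> h \in G -> to x h != x ->
  (to x h \in X) = (x \in X) -> ~~ odd #|orbit to G x :&: X|.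
Proof.
move=> card2 hG xh Xh.
by rewrite (card2_orbitI _ card2 hG xh) Xh addnn odd_double.
Qed.

End SmallOrbits.

(** * Block intersections along point orbits *)

Section IntersectionNumbers.

Variables (P B : finType) (inc : P -> B -> bool).
Variable (G : {group {perm P} * {perm B}}).
Hypothesis autG : automorphism_group inc G.

Let pto : {action {perm P} * {perm B} &-> P} := point_action P B.
Let bto : {action {perm P} * {perm B} &-> B} := block_action P B.
Let pts (b : B) : {set P} := [set x | inc x b].

Lemma block_intersectionE b c : block_intersection inc b c = #|pts b :&: pts c|.
Proof. by apply: eq_card => x; rewrite !inE. Qed.

Lemma card_orbit_entry b x :
  orbit_entry inc (orbit bto G b) (orbit pto G x) = #|orbit pto G x :&: pts b|.
Proof.
rewrite (orbit_entryE _ autG (orbit_refl bto G b)).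
by apply: eq_card => y; rewrite !inE.
Qed.

Lemma mem_pts_act g x b : g \in G -> (pto x g \in pts (bto b g)) = (x \in pts b).
Proof. by move=> gG; rewrite !inE; apply: autG. Qed.

Lemma mem_pts_fixed g x b :
  g \in G -> bto b g = b -> (pto x g \in pts b) = (x \in pts b).
Proof. by move=> gG bg; rewrite -{1}bg mem_pts_act. Qed.

(** An element h swapping the points of the orbit of x either fixes b or swaps
    b with the same block as g does; in the second case g * h fixes b and still
    swaps the two points.  So b contains both points or neither. *)
Lemma card2_entry_even b x g :
  #|orbit pto G x| = 2 -> #|orbit bto G b| = 2 ->
  g \in G -> bto b g != b -> pto x g = x -> ~~ odd #|orbit pto G x :&: pts b|.
Proof.
move=> cardx cardb gG bg xg; have [h hG xh] := card2_orbit_moved cardx.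
have [bh|bh] := eqVneq (bto b h) b.
  by apply: (card2_orbitI_even cardx hG xh); apply: mem_pts_fixed.
have xgh : pto x (g * h)%g = pto x h by rewrite actM xg.
have ghG : (g * h)%g \in G by rewrite groupM.
apply: (card2_orbitI_even cardx ghG); rewrite ?xgh //.
rewrite -xgh; apply: mem_pts_fixed => //.
rewrite actM (card2_orbit_act_eq cardb gG hG bg bh).
exact: card2_orbit_invol cardb hG.
Qed.

(** When g fixes the points of the orbit, the two terms on the left are equal
    and the entry of b is even, by card2_entry_even.  When g swaps the points
    x, y of the orbit, the image of c contains x iff c contains y, so the left
    side counts the pairs of points with one in b and one in c. *)
Lemma card2_orbit_product b c x g :
  #|orbit pto G x| = 2 -> #|orbit bto G b| = 2 -> g \in G -> bto b g != b ->
  odd (#|orbit pto G x :&: (pts b :&: pts c)|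
       + #|orbit pto G x :&: (pts b :&: pts (bto c g))|)
  = odd (#|orbit pto G x :&: pts b| * #|orbit pto G x :&: pts c|).
Proof.
move=> cardx cardb gG bg; rewrite oddM.
have [xg|xg] := eqVneq (pto x g) x.
  rewrite (negPf (card2_entry_even cardx cardb gG bg xg)) /=.
  rewrite (_ : _ :&: (_ :&: pts (bto c g)) = orbit pto G x :&: (pts b :&: pts c)).
    by rewrite addnn odd_double.
  apply/setP => y; rewrite !in_setI; case: (boolP (y \in orbit _ _ _)) => //= yx.
  by rewrite -(mem_pts_act y c gG) (card2_orbit_fixed cardx gG xg yx).
(* Membership of x in c g is moved to pto x g in c by applying g again. *)
rewrite !(card2_orbitI _ cardx gG xg) !in_setI mem_pts_act //.
rewrite -(mem_pts_act (pto x g) c gG) (card2_orbit_invol cardx gG).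
by do 4!case: (_ \in pts _).
Qed.

Lemma mem_pts_orbit1 x b g :
  orbit bto G b = [set b] -> g \in G -> (pto x g \in pts b) = (x \in pts b).
Proof.
move=> fixb gG; apply: mem_pts_fixed => //.
by apply/set1P; rewrite -fixb mem_orbit.
Qed.

(** * Gram matrices of the two parts of the orbit matrix *)

Variables (f1 n f2 m : nat).
Variables (V : 'I_(f1 + n) -> {set P}) (W : 'I_(f2 + m) -> {set B}).
Hypotheses (hV : orbit_ordering pto G V) (hW : orbit_ordering bto G W).

Let A := orbit_matrix inc W V.

Let OM1E i j : OM1 A i j = (orbit_entry inc (W (lshift m i)) (V (lshift n j)))%:R.
Proof. by rewrite !mxE. Qed.

Let OM2E i j : OM2 A i j = (orbit_entry inc (W (rshift f2 i)) (V (rshift f1 j)))%:R.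
Proof. by rewrite !mxE. Qed.

(** Point orbits of length 2 are contained in or disjoint from a fixed block,
    so they contribute evenly to the intersection number. *)
Lemma OM1_dot i i' b c :
  W (lshift m i) = orbit bto G b -> W (lshift m i') = orbit bto G c ->
  (OM1 A *m (OM1 A)^T) i i' = (block_intersection inc b c)%:R.
Proof.
move=> Wi Wi'; have [_ _ V1 V2] := hV; have [_ _ W1 _] := hW.
have fixb : orbit bto G b = [set b] by apply: card_orbit1; rewrite -Wi W1.
have fixc : orbit bto G c = [set c] by apply: card_orbit1; rewrite -Wi' W1.
rewrite block_intersectionE (card_orbit_ordering _ hV) natr_sum big_split_ord /=.
rewrite [X in _ = _ + X]big1 ?addr0 => [|j _]; last first.
  have [x Vj] := orbit_ordering_orbit (rshift f1 j) hV.
  have cardx : #|orbit pto G x| = 2 by rewrite -Vj V2.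
  have [h hG xh] := card2_orbit_moved cardx.
  rewrite natr_F2 Vj (negPf (card2_orbitI_even cardx hG xh _)) //.
  by rewrite !in_setI !mem_pts_orbit1.
rewrite mxE; apply: eq_bigr => j _.
have [x Vj] := orbit_ordering_orbit (lshift n j) hV.
have fixx : orbit pto G x = [set x] by apply: card_orbit1; rewrite -Vj V1.
rewrite [_^T _ _]mxE !OM1E Wi Wi' Vj !card_orbit_entry -natrM fixx.
by rewrite !card_set1I in_setI; do 2!case: (_ \in _).
Qed.

(** A fixed point lies in c iff it lies in the image of c under g, so its two
    contributions are equal; the other orbits are handled by card2_orbit_product. *)
Lemma OM2_dot i i' b c g :
  W (rshift f2 i) = orbit bto G b -> W (rshift f2 i') = orbit bto G c ->
  g \in G -> bto b g != b ->
  (OM2 A *m (OM2 A)^T) i i'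
  = (block_intersection inc b c + block_intersection inc b (bto c g))%:R.
Proof.
move=> Wi Wi' gG bg; have [_ _ V1 V2] := hV; have [_ _ _ W2] := hW.
have cardb : #|orbit bto G b| = 2 by rewrite -Wi W2.
rewrite !block_intersectionE !(card_orbit_ordering _ hV) -big_split natr_sum.
rewrite big_split_ord /= big1 ?add0r => [|j _]; last first.
  have [x Vj] := orbit_ordering_orbit (lshift n j) hV.
  have fixx : orbit pto G x = [set x] by apply: card_orbit1; rewrite -Vj V1.
  have xg : pto x g = x by apply/set1P; rewrite -fixx mem_orbit.
  rewrite natr_F2 Vj fixx !card_set1I !in_setI.
  by rewrite -(mem_pts_act x c gG) xg addnn odd_double.
rewrite mxE; apply: eq_bigr => j _.
have [x Vj] := orbit_ordering_orbit (rshift f1 j) hV.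
rewrite [_^T _ _]mxE !OM2E Wi Wi' Vj !card_orbit_entry -natrM.
by apply: natr_F2_eq; rewrite card2_orbit_product // -Vj V2.
Qed.

Hypothesis even_blocks : forall b, ~~ odd #|pts b|.
Hypothesis odd_int : odd_block_intersections inc.

Let odd_block_intersection b c : odd (block_intersection inc b c) = (b != c).
Proof.
have [<-|/odd_int->//] := eqVneq b c.
by rewrite block_intersectionE setIid (negPf (even_blocks b)).
Qed.

Lemma OM1_gram : OM1 A *m (OM1 A)^T = const_mx 1 + 1%:M.
Proof.
apply/matrixP => i i'; have [injW _ W1 _] := hW.
have [b Wi] := orbit_ordering_orbit (lshift m i) hW.
have [c Wi'] := orbit_ordering_orbit (lshift m i') hW.
have eq_bc : (b == c) = (i == i').
  rewrite -(inj_eq (@lshift_inj f2 m)) -(inj_eq injW) Wi Wi'.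
  rewrite (card_orbit1 (_ : #|orbit bto G b| = 1%N)) -?Wi ?W1 //.
  rewrite (card_orbit1 (_ : #|orbit bto G c| = 1%N)) -?Wi' ?W1 //.
  by rewrite (inj_eq set1_inj).
rewrite (OM1_dot Wi Wi') !mxE natr_F2 odd_block_intersection eq_bc.
by case: (i == i'); apply/eqP.
Qed.

(** For a diagonal entry OM2_dot is used with c = b, so that b and its image
    by g are the two blocks of one orbit; for the other entries c and its image
    both differ from b, which lies in another orbit. *)
Lemma OM2_gram : OM2 A *m (OM2 A)^T = 1%:M.
Proof.
apply/matrixP => i i'; have [injW _ _ W2] := hW.
have [b Wi] := orbit_ordering_orbit (rshift f2 i) hW.
have cardb : #|orbit bto G b| = 2 by rewrite -Wi W2.
have [g gG bg] := card2_orbit_moved cardb.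
rewrite [RHS]mxE; have [<-|ne_i] := eqVneq i i'.
  rewrite (OM2_dot Wi Wi gG bg) natr_F2 oddD !odd_block_intersection.
  by rewrite eqxx eq_sym bg.
have [c Wi'] := orbit_ordering_orbit (rshift f2 i') hW.
have b_notin_c : b \notin orbit bto G c.
  apply: contraNN ne_i => /orbit_eqP eq_orb.
  by rewrite -(inj_eq (@rshift_inj f2 m)) -(inj_eq injW) Wi Wi' eq_orb.
have b_neq d : d \in orbit bto G c -> b != d.
  by move=> dc; apply: contraNneq b_notin_c => ->.
rewrite (OM2_dot Wi Wi' gG bg) natr_F2 oddD !odd_block_intersection.
by rewrite !b_neq ?orbit_refl ?mem_orbit.
Qed.

End IntersectionNumbers.

Theorem theorem12 (P B : finType) (inc : P -> B -> bool) (v k r : nat)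
    (f1 n f2 m : nat) (G : {group {perm P} * {perm B}})
    (V : 'I_(f1 + n) -> {set P}) (W : 'I_(f2 + m) -> {set B})
    (hD : one_design inc v k r)
    (hwso : weakly_self_orthogonal inc)
    (hk : ~~ odd k)
    (hodd : odd_block_intersections inc)
    (hG : automorphism_group inc G)
    (hV : orbit_ordering (point_action P B) G V)
    (hW : orbit_ordering (block_action P B) G W) :
  let A := orbit_matrix inc W V in
  let C1 : {vspace 'rV['F_2]_(f2 + f1 + 1)} :=
    row_code (row_mx (row_mx 1%:M (OM1 A)) (const_mx 1)) in
  let C2 : {vspace 'rV['F_2]_(m + n)} :=
    row_code (row_mx 1%:M (OM2 A)) in
  [/\ self_orthogonal C1 /\ \dim C1 = f2,
      self_orthogonal C2 /\ \dim C2 = m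
    & m = n -> self_dual C2].
Proof.
have even_blocks b : ~~ odd #|[set x | inc x b]| by case: hD => _ -> _.
have gram1 := OM1_gram hG hV hW even_blocks hodd.
have gram2 := OM2_gram hG hV hW even_blocks hodd.
split; last by move=> eq_mn; apply: self_dual_systematic.
  split; last exact/dim_row_code/row_free_row_mx/row_free_row_mx/row_free1.
  apply: self_orthogonal_row_code.
  rewrite !tr_row_mx !mul_row_col trmx1 mulmx1 gram1.
  have -> : @const_mx 'F_2 f2 1 1 *m (const_mx 1)^T = const_mx 1 :> 'M_f2.
    by apply/matrixP => i j; rewrite !(big_ord1, mxE) mulr1.
  by rewrite addrCA addrr_F2 addr0 addrr_F2.
split; last exact/dim_row_code/row_free_row_mx/row_free1.
apply: self_orthogonal_row_code.
by rewrite tr_row_mx mul_row_col trmx1 mulmx1 gram2 addrr_F2.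
Qed.
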